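(* Let $n\ge1$, let $a$ be a monic real polynomial of degree at most $n$, let $b$ be a nonzero real polynomial of degree at most $n-1$, and let $p(x)=\dfrac{1}{|a(x)|}\exp\Big(\dfrac{2}{n}\displaystyle\int_{p_0}^x\frac{b(t)}{a(t)}dt\Big)$ on $I$, with $p_0\in I$ a fixed base point. (i) Suppose $a$ has no real roots and $I=(-\infty,\infty)$. Then $p$ gives finite norm for all polynomials if and only if $\deg b-\deg a$ is an odd positive integer and the leading coefficient of $b$ is negative. (ii) Suppose $a$ has only one real root, namely $0$, and $I=(0,\infty)$. Then $p$ gives finite norm for all polynomials if and only if both of the following hold: (a) $\deg b-\deg a\ge0$ and the leading coefficient of $b$ is negative; (b) writing $a=x^{\alpha}(A_0+A_1x+\cdots)$ and $b=x^{\beta}(B_0+B_1x+\cdots)$ with $A_0,B_0$ nonzero constants, one has $\alpha-\beta\ge1$, and moreover $\frac{B_0}{A_0}>0$ if $\alpha-\beta\ge2$, whereas $\frac{2B_0}{nA_0}-\alpha+1>0$ if $\alpha-\beta=1$.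
   Context: ''$p$ gives finite norm for all polynomials'' means $\int_I p(x)\,u(x)^2\,dx<\infty$ for every real polynomial $u$. *)

(* Defs.v *)
From mathcomp Require Import all_boot all_order all_algebra.
From mathcomp Require Import all_classical all_reals all_analysis.
Set Implicit Arguments.
Unset Strict Implicit.
Unset Printing Implicit Defensive.
Import Order.TTheory GRing.Theory Num.Theory.
Local Open Scope classical_set_scope.
Local Open Scope ring_scope.

(* For nonzero polynomials only: the zero polynomial gets degree 0. *)
Definition degree (R : realType) (q : {poly R}) : nat := (size q).-1.

(* The library integrates over sets, so the usual sign convention for
   u > v has to be added by hand. *)
Definition oriented_integral (R : realType) (f : R -> R) (u v : R) : R :=
  if u <= v then \int[lebesgue_measure]_(t in `[u, v]) f t
  else - \int[lebesgue_measure]_(t in `[v, u]) f t.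

Definition weight (R : realType) (n : nat) (a b : {poly R}) (p0 x : R) : R :=
  `|a.[x]|^-1 *
  expR (2 / n%:R * oriented_integral (fun t => b.[t] / a.[t]) p0 x).

Definition finite_norm_all_poly (R : realType) (I : set R) (p : R -> R) : Prop :=
  forall u : {poly R},
    (\int[lebesgue_measure]_(x in I) (p x * u.[x] ^+ 2)%:E < +oo)%E.

(* Main.v *)
Require Import Defs.
From mathcomp Require Import all_boot all_order all_algebra.
From mathcomp Require Import all_classical all_reals all_analysis.
From mathcomp Require Import measurable_realfun polyrcf zify ring lra.
Set Implicit Arguments.
Unset Strict Implicit.
Unset Printing Implicit Defensive.
Import Order.TTheory GRing.Theory Num.Theory.
Import numFieldNormedType.Exports.
Local Open Scope classical_set_scope.
Local Open Scope ring_scope.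

(** Why the characterisation holds.

    Write [c = 2 / n], let [G] be the primitive of [b / a] used in the weight,
    [E = exp (c G)] and [w = E / |a|].  For a nonnegative continuous density,
    a primitive [H_u] of [w u^2] decides finiteness of the integral: it must
    stay bounded above towards the right end of the interval and bounded below
    towards its left end ([integral_lt_pinfty_primitive]).  From there on only
    derivatives are compared, one end of the interval at a time, on an interval
    where [a > 0].

    The computation behind every comparison is that, for a test function [v],
    the derivative of [v E] is [w (v' a + c v b)].  When [v] is a power of [x]
    the bracket is, up to a power of [x], a polynomial, so its sign near an end
    is the sign of one coefficient.

    At [+oo], take [v = x^N].  If [deg a <= deg b] and [b] has a negative
    leading coefficient, then for large [N] the derivative of [v E] is
    eventually below [- w u^2]; as [v E] is nonnegative, [H_u] is bounded
    ([moments_bounded_at_infinity]).  Otherwise [x^N E] eventually increases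
    for some [N], hence [w a x^N] stays away from [0] and the polynomial
    [u = 1 + a x^N] has infinite norm ([infinity_conditions_necessary]).

    At [0], write the order of vanishing of [a] as [alpha + 1].  If the
    conditions hold, [v = x^(- beta)] makes the bracket tend to a positive
    constant, so [w u^2] is dominated by the derivative of a bounded function
    ([moments_bounded_at_zero]).  If one of them fails, the logarithm of
    [x^(- alpha) E] has a derivative bounded above near [0], hence
    [E >= const * x^alpha], and [w >= const / x] is not integrable
    ([zero_conditions_necessary]).

    On the half line the two ends give exactly the two groups of conditions.
    On the whole line the end [-oo] is the end [+oo] of the reflected data
    [a(- x)] and [- b(- x)].  A positive [a] has even degree, so the leading
    coefficient of [- b(- x)] is negative together with that of [b] exactly
    when [deg b] is odd. *)

(** * Primitives and finiteness of integrals *)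

Section Primitives.
Context {R : realType}.
Implicit Types (f h F H : R -> R) (I : set R).

Lemma continuous_at_within f (i : interval R) :
  (forall x, x \in i -> {for x, continuous f}) ->
  {within [set` i], continuous f}.
Proof.
move=> cf; apply: continuous_in_subspaceT => x; rewrite inE /= => xi.
exact: cf.
Qed.

Lemma integral_segment_primitive f F (s t : R) : s <= t ->
  (forall x, x \in `[s, t] -> is_derive x 1 F (f x)) ->
  (forall x, x \in `[s, t] -> {for x, continuous f}) ->
  (\int[lebesgue_measure]_(x in `[s, t]) (f x)%:E)%E = (F t - F s)%:E.
Proof.
move=> + dF cf; rewrite le_eqVlt => /predU1P[->|st].
  by rewrite set_itv1 integral_set1 subrr.
have wF : {within `[s, t], continuous F}.
  by apply: derivable_within_continuous => x /dF ?; exact: ex_derive.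
rewrite (@continuous_FTC2 _ f F)//.
- exact: continuous_at_within.
- split.
  + by move=> x /subset_itv_oo_cc /dF ?; exact: ex_derive.
  + by move/continuous_within_itvP : wF => /(_ st)[].
  + by move/continuous_within_itvP : wF => /(_ st)[].
- move=> x /subset_itv_oo_cc /dF dFx.
  by rewrite derive1E; exact: derive_val.
Qed.

(** Replacing the base point [p] by a point [s] to the left of everything
    removes the case distinction on the order of the bounds, so that the
    fundamental theorem of calculus applies on both sides of [p]. *)
Lemma oriented_integral_shift f (s u p x : R) :
  lebesgue_measure.-integrable `[s, u] (EFin \o f) ->
  p \in `[s, u] -> x \in `[s, u] ->
  oriented_integral f p x =
  \int[lebesgue_measure]_(t in `[s, x]) f t
  - \int[lebesgue_measure]_(t in `[s, p]) f t.
Proof.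
move=> fi.
have key (y z : R) : y \in `[s, u] -> z \in `[s, u] -> y <= z ->
    \int[lebesgue_measure]_(t in `[y, z]) f t =
    \int[lebesgue_measure]_(t in `[s, z]) f t
    - \int[lebesgue_measure]_(t in `[s, y]) f t.
  rewrite !in_itv/= => /andP[sy yu] /andP[sz zu] yz.
  have fi' (v w : itv_bound R) : (BLeft s <= v)%O -> (w <= BRight u)%O ->
      lebesgue_measure.-integrable [set` Interval v w] (EFin \o f).
    move=> sv wu; apply: integrableS fi => //.
    by move=> t /= /andP[h1 h2]; apply/andP; split;
      [exact: le_trans sv h1 | exact: le_trans h2 wu].
  rewrite Rintegral_itvB ?bnd_simp//; last exact: fi'.
  by rewrite Rintegral_itv_obnd_cbnd//; apply: fi'; rewrite bnd_simp.
move=> pI xI; rewrite /oriented_integral; case: ifPn => [px|].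
  exact: key.
by rewrite -ltNge => /ltW xp; rewrite (key x p)// opprB.
Qed.

Lemma open_interval_around I (p q : R) : open I -> I p -> I q ->
  exists s u, [/\ I s, I u, s < p < u & s < q < u].
Proof.
move=> oI Ip Iq.
have nb (y : R) : I y -> exists2 e : R, 0 < e & I (y - e) /\ I (y + e).
  move=> Iy; have /nbhs_ballP[e /= e0 He] : nbhs y I by exact: open_nbhs_nbhs.
  exists (e / 2); first by rewrite divr_gt0.
  have e2 : `|e / 2| < e by rewrite gtr0_norm ?divr_gt0//; lra.
  by split; apply: He; rewrite /ball/= ?opprB ?opprD ?addNKr ?normrN// addrC subrK.
have [e e0 [Ipl Ipr]] := nb _ Ip; have [d d0 [Iql Iqr]] := nb _ Iq.
case: (leP p q) => pq.
  by exists (p - e), (q + d); split => //; apply/andP; split; lra.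
by exists (q - d), (p + e); split => //; apply/andP; split; lra.
Qed.

Lemma is_derive_oriented_integral f I (p x : R) : open I -> is_interval I ->
  (forall y, I y -> {for y, continuous f}) -> I p -> I x ->
  is_derive x 1 (oriented_integral f p) (f x).
Proof.
move=> oI iI cf Ip Ix.
have [s [u [Is Iu /andP[sp pu] /andP[sx xu]]]] := open_interval_around oI Ip Ix.
have fi : lebesgue_measure.-integrable `[s, u] (EFin \o f).
  apply: continuous_compact_integrable; first exact: segment_compact.
  apply: continuous_at_within => y; rewrite in_itv/= => yI; apply: cf.
  exact: iI Is Iu _ yI.
have [dF Fx] := continuous_FTC1_closed xu fi sx (cf _ Ix).
set F := (fun _ => _) in dF Fx.
have dF' : is_derive x 1 F (f x) := DeriveDef dF (etrans (esym (derive1E F x)) Fx).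
apply: (@near_eq_is_derive _ _ _ (fun y => F y - F p)).
  near=> y; rewrite (@oriented_integral_shift _ s u)// in_itv/=.
    by rewrite !ltW.
  apply/andP; split; apply: ltW; near: y.
    exact: lt_nbhsr.
  exact: lt_nbhsl.
rewrite -[f x]subr0.
by apply: is_deriveB.
Unshelve. all: by end_near. Qed.

(** All later estimates are instances of this: a bound on the integral of a
    density is a bound on the increments of its primitive, and these are
    compared with those of an explicit function. *)
Lemma increment_le F h H f (s t : R) : s <= t ->
  (forall x, x \in `[s, t] -> is_derive x 1 F (f x)) ->
  (forall x, x \in `[s, t] -> is_derive x 1 H (h x)) ->
  (forall x, x \in `[s, t] -> f x <= h x) ->
  F t - F s <= H t - H s.
Proof.
move=> st dF dH fh.
have dD x : x \in `[s, t] -> is_derive x 1 (H - F) (h x - f x).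
  by move=> xst; apply: is_deriveB; [exact: dH | exact: dF].
have cD : {within `[s, t], continuous (H - F)}.
  by apply: derivable_within_continuous => x /dD ?; exact: ex_derive.
have [c cst E] := @MVT_segment _ (H - F) (fun x => h x - f x) _ _ st
  (fun x xst => dD x (subset_itv_oo_cc xst)) cD.
have : 0 <= (h c - f c) * (t - s) by rewrite mulr_ge0// subr_ge0// fh.
rewrite -E -[(H - F) t]/(H t - F t) -[(H - F) s]/(H s - F s).
lra.
Qed.

Lemma nondecreasing_derive F f (s t : R) : s <= t ->
  (forall x, x \in `[s, t] -> is_derive x 1 F (f x)) ->
  (forall x, x \in `[s, t] -> 0 <= f x) -> F s <= F t.
Proof.
move=> st dF f0; rewrite -subr_ge0 -[leLHS](subrr 0).
exact: (@increment_le (cst 0) f F (cst 0) _ _ st _ dF f0).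
Qed.

(** The primitive [H] is nondecreasing, so its bounds next to the two ends are
    bounds for all its increments; monotone convergence along an exhaustion of
    [I] by segments turns these into a bound for the integral.  The points [p]
    and [q] delimit the neighbourhoods of the two ends. *)
Lemma integral_lt_pinfty_primitive I (s t : R^nat) h H (p q : R) :
  open I -> is_interval I ->
  nonincreasing_seq s -> nondecreasing_seq t -> (forall k, s k <= t k) ->
  I = \bigcup_k (`[s k, t k]%classic) ->
  (forall x, I x -> {for x, continuous h}) ->
  (forall x, I x -> 0 <= h x) ->
  (forall x, I x -> is_derive x 1 H (h x)) -> I p -> I q ->
  (\int[lebesgue_measure]_(x in I) (h x)%:E < +oo)%E <->
  (exists K, forall x, I x -> p <= x -> H x <= K) /\
  (exists K, forall x, I x -> x <= q -> K <= H x).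
Proof.
move=> oI iI ns nt st IE ch h0 dH Ip Iq.
have sub (x y : R) : I x -> I y -> `[x, y]%classic `<=` I.
  by move=> Ix Iy z /=; rewrite in_itv/= => xyz; exact: iI Ix Iy _ xyz.
have Is k : I (s k) by rewrite IE; exists k => //=; rewrite in_itv/= lexx st.
have It k : I (t k) by rewrite IE; exists k => //=; rewrite in_itv/= lexx st.
have H_nd (x y : R) : I x -> I y -> x <= y -> H x <= H y.
  move=> Ix Iy xy; apply: (nondecreasing_derive (f := h) xy).
  - by move=> z zxy; apply: dH; exact: sub zxy.
  - by move=> z zxy; apply: h0; exact: sub zxy.
have Hint (x y : R) : I x -> I y -> x <= y ->
    (\int[lebesgue_measure]_(z in `[x, y]) (h z)%:E = (H y - H x)%:E)%E.
  move=> Ix Iy xy; apply: integral_segment_primitive => // z zxy.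
    by apply: dH; exact: sub zxy.
  by apply: ch; exact: sub zxy.
have mI : measurable I by exact: open_measurable.
have mh : measurable_fun I (EFin \o h).
  apply/measurable_EFinP; apply: open_continuous_measurable_fun => // x.
  by rewrite inE; exact: ch.
split=> [fin | [[K1 HK1] [K2 HK2]]].
- pose K := fine (\int[lebesgue_measure]_(x in I) (h x)%:E)%E.
  have HK (x y : R) : I x -> I y -> x <= y -> H y - H x <= K.
    move=> Ix Iy xy; rewrite -lee_fin -Hint// /K fineK; last first.
      by rewrite ge0_fin_numE//; apply: integral_ge0 => z Iz; rewrite lee_fin h0.
    by apply: ge0_subset_integral => //; exact: sub.
  split.
    by exists (K + H p) => x Ix px; rewrite -lerBlDr; exact: HK.
  by exists (H q - K) => x Ix xq; rewrite lerBlDl -lerBlDr; exact: HK.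
- have bnd k : (\int[lebesgue_measure]_(x in `[s k, t k]) (h x)%:E
      <= (K1 - K2)%:E)%E.
    rewrite Hint// lee_fin lerB//.
      case: (leP p (t k)) => [/HK1|/ltW tp]; first exact.
      by apply: (@le_trans _ _ (H p)); [exact: H_nd | exact: HK1].
    case: (leP (s k) q) => [/HK2|/ltW qs]; first exact.
    by apply: (@le_trans _ _ (H q)); [exact: HK2 | exact: H_nd].
  apply: (@le_lt_trans _ _ (K1 - K2)%:E); last exact: ltry.
  have cv : ((\int[lebesgue_measure]_(x in `[s i, t i]) (h x)%:E) @[i --> \oo]
      --> \int[lebesgue_measure]_(x in I) (h x)%:E)%E.
    rewrite [in X in _ --> X]IE.
    apply: ge0_nondecreasing_set_cvg_integral => //.
    + move=> i j ij; rewrite subsetEset => x /=; rewrite !in_itv/=.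
      by move=> /andP[sx xt]; rewrite (le_trans (ns _ _ ij))//=
         (le_trans xt (nt _ _ ij)).
    + by move=> k; apply: measurable_funS mh => //; exact: sub.
    + by move=> k x xst; rewrite lee_fin; apply: h0; exact: sub xst.
  rewrite -(cvg_lim _ cv)//; apply: lime_le; first by apply/cvg_ex; eexists; exact: cv.
  by apply: nearW => k; exact: bnd.
Qed.

End Primitives.

(** * Signs of polynomials near the ends of an interval *)

Section SignsOfPolynomials.
Context {R : realType}.
Implicit Types (a b p : {poly R}) (c : R).

Lemma eventually_pos (p : {poly R}) : 0 < lead_coef p ->
  exists2 M : R, 1 <= M & forall x, M <= x -> 0 < p.[x].
Proof.
move=> p0; have [M HM] := poly_pinfty_gt_lc p0.
exists (Num.max 1 M); first by rewrite le_max lexx.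
by move=> x; rewrite ge_max => /andP[_ /HM]; exact: lt_le_trans.
Qed.

Lemma pos_near_zero (p : {poly R}) : 0 < p`_0 ->
  exists2 d : R, 0 < d <= 1 & forall x, 0 <= x -> x <= d -> 0 < p.[x].
Proof.
move=> p0; have : \forall x \near 0, 0 < p.[x].
  have cp := @continuous_horner R p 0.
  by apply: (cvgr_gt p.[0] cp); rewrite horner_coef0.
move=> /nbhs_ballP[e /= e0 He].
exists (Num.min 1 (e / 2)).
  by rewrite ge_min lexx lt_min ltr01 divr_gt0.
move=> x x0; rewrite le_min => /andP[_ xe]; apply: He.
rewrite /ball/= sub0r normrN ger0_norm//; lra.
Qed.

Lemma horner_gt0_of_noroot a (l : R) : 0 < lead_coef a ->
  (forall x, l < x -> ~~ root a x) -> forall x, l < x -> 0 < a.[x].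
Proof.
move=> la nr x lx; rewrite ltNge; apply/negP => ax.
have [M _ HM] := eventually_pos la.
pose y := Num.max x M; have xy : x <= y by rewrite le_max lexx.
have ay : 0 < a.[y] by apply: HM; rewrite le_max lexx orbT.
have [|z] := @poly_ivt _ a _ _ xy; first by rewrite ax ltW.
move=> /andP[xz _] rz.
by have := nr z (lt_le_trans lx xz); rewrite rz.
Qed.

Lemma lead_coef_gt0_of_horner a :
  (forall x : R, 0 < x -> 0 < a.[x]) -> 0 < lead_coef a.
Proof.
move=> a_gt0; have a0 : a != 0.
  by apply: contraTneq (a_gt0 1 ltr01) => ->; rewrite horner0 ltxx.
rewrite lt_neqAle eq_sym lead_coef_eq0 a0 /= leNgt; apply/negP => la.
have [|M M1 HM] := @eventually_pos (- a); first by rewrite lead_coefN oppr_gt0.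
have := HM M (lexx M); have : 0 < a.[M] by apply: a_gt0; lra.
by rewrite hornerN; lra.
Qed.

Lemma lead_coef_of_bound (p : {poly R}) (k : nat) :
  (size p <= k.+1)%N -> p`_k != 0 -> lead_coef p = p`_k.
Proof.
move=> sp pk; have p0 : (k < size p)%N.
  by rewrite ltnNge; apply: contraNN pk => /leq_sizeP ->.
have -> : k = (size p).-1; last by [].
by apply/eqP; rewrite -eqSS (ltn_predK p0) eqn_leq p0 sp.
Qed.

(** The polynomial [(m + 1) a + c x b] governs the sign of the derivative of
    [x^(m + 1) E].  If [deg b >= deg a], the term [c x b] dominates and has a
    positive leading coefficient; if [deg b < deg a], the coefficient of
    [(m + 1) a] in degree [deg a] wins once [m] is large, even when [x b] has
    the same degree. *)
Lemma lead_coef_moment_gt0 a b c : 0 < c -> 0 < lead_coef a -> b != 0 ->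
  ~ ((degree a <= degree b)%N /\ lead_coef b < 0) ->
  exists m : nat, 0 < lead_coef (m.+1%:R *: a + c *: (b * 'X)).
Proof.
move=> c0 la b0 nab.
have sXb : size (c *: (b * 'X)) = (size b).+1.
  by rewrite size_scale ?gt_eqF// size_mulX.
have lXb : lead_coef (c *: (b * 'X)) = c * lead_coef b.
  by rewrite lead_coefZ lead_coefMX.
have sb : (0 < size b)%N by rewrite size_poly_gt0.
have a0 : a != 0 by rewrite -lead_coef_eq0 gt_eqF.
have sa : (0 < size a)%N by rewrite size_poly_gt0.
case: (leqP (size a) (size b)) => [sab|sba].
- exists 0%N; rewrite scale1r lead_coefDr ?sXb ?ltnS// lXb mulr_gt0//.
  rewrite ltNge le_eqVlt lead_coef_eq0 (negPf b0)/=; apply/negP => lb.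
  by apply: nab; split=> //; rewrite /degree -!subn1 leq_sub2r.
- pose z := `|(c *: (b * 'X))`_(size a).-1| / lead_coef a.
  have [m zm] : exists m : nat, z < m.+1%:R.
    by exists (Num.truncn z); exact: truncnS_gt.
  exists m.
  have P : 0 < (m.+1%:R *: a + c *: (b * 'X))`_(size a).-1.
    rewrite coefD coefZ -/(lead_coef a); move: zm.
    rewrite ltr_pdivrMr// => zm.
    have := ler_norm (- (c *: (b * 'X))`_(size a).-1); rewrite normrN; lra.
  rewrite (@lead_coef_of_bound _ (size a).-1)// ?gt_eqF//.
  rewrite (ltn_predK sa) (leq_trans (size_polyD _ _))// geq_max sXb sba andbT.
  exact: size_scale_leq.
Qed.

Lemma horner_reflect (p : {poly R}) x : (p \Po - 'X).[x] = p.[- x].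
Proof. by rewrite horner_comp hornerN hornerX. Qed.

Lemma lead_coef_reflect (p : {poly R}) :
  lead_coef (p \Po - 'X) = (-1) ^+ degree p * lead_coef p.
Proof.
by rewrite lead_coef_comp ?size_polyN ?size_polyX// lead_coefN lead_coefX mulrC.
Qed.

Lemma degree_reflect (p : {poly R}) : degree (p \Po - 'X) = degree p.
Proof. by rewrite /degree size_comp_poly2// size_polyN size_polyX. Qed.

Lemma reflectK (p : {poly R}) : (p \Po - 'X) \Po - 'X = p.
Proof. by rewrite -comp_polyA raddfN /= comp_polyX opprK comp_polyXr. Qed.

End SignsOfPolynomials.

(** * Bounded moments at infinity *)

Section Weights.
Context {R : realType}.
Implicit Types (a b u v A B : {poly R}) (c : R) (G : R -> R).

Definition exp_weight a c G (x : R) : R := `|a.[x]|^-1 * expR (c * G x).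

Lemma exp_weight_ge0 a c G x : 0 <= exp_weight a c G x.
Proof. by rewrite mulr_ge0// ?invr_ge0// expR_ge0. Qed.

Lemma exp_weightM a c G x : 0 < a.[x] ->
  exp_weight a c G x * a.[x] = expR (c * G x).
Proof.
by move=> a0; rewrite /exp_weight gtr0_norm// mulrAC mulVf ?mul1r// gt_eqF.
Qed.

(** Differentiating [E] produces the factor [b / a], and [E / a] is the weight
    again: this is what makes polynomial multiples of [E] natural comparison
    functions. *)
Lemma is_derive_polyM_exp a b c G v (x : R) : 0 < a.[x] ->
  is_derive x 1 G (b.[x] / a.[x]) ->
  is_derive x 1 (fun y => v.[y] * expR (c * G y))
    (exp_weight a c G x * (v^`() * a + c *: (v * b)).[x]).
Proof.
move=> a0 dG.
have dcG : is_derive x 1 (fun y => c * G y) (c * (b.[x] / a.[x])).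
  exact: is_deriveZ.
have dE := @is_derive1_comp _ expR _ x _ _ (is_derive_expR (c * G x)) dcG.
have D := is_deriveM (is_derive_poly v x) dE.
apply: is_derive_eq D _.
rewrite /exp_weight gtr0_norm// !hornerE /= /GRing.scale/=.
by field; rewrite gt_eqF.
Qed.

(* [H u] stands for any primitive of the weighted square of [u]. *)
Section HalfLine.
Variables (a b : {poly R}) (c : R) (G : R -> R) (H : {poly R} -> R -> R).
Hypothesis c0 : 0 < c.
Hypothesis a_gt0 : forall x : R, 0 < x -> 0 < a.[x].
Hypothesis dG : forall x : R, 0 < x -> is_derive x 1 G (b.[x] / a.[x]).
Hypothesis dH : forall u (x : R), 0 < x ->
  is_derive x 1 (H u) (exp_weight a c G x * u.[x] ^+ 2).

Let w := exp_weight a c G.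

Lemma moment_nondecreasing u (x y : R) : 0 < x -> x <= y -> H u x <= H u y.
Proof.
move=> x0 xy.
apply: (nondecreasing_derive (f := fun z => w z * u.[z] ^+ 2) xy).
  move=> z; rewrite in_itv/= => /andP[xz _]; apply: dH.
  exact: lt_le_trans xz.
by move=> z _; rewrite mulr_ge0// ?sqr_ge0// exp_weight_ge0.
Qed.

(** The product [x^(m + 1) E] is nonnegative and eventually decreases at least
    as fast as [H u] increases, so its value at one point bounds all that [H u]
    can still gain. *)
Lemma moments_bounded_at_infinity :
  b != 0 -> (degree a <= degree b)%N -> lead_coef b < 0 ->
  forall u, exists K, forall x : R, 1 <= x -> H u x <= K.
Proof.
move=> b0 dab lb u.
(* This exponent makes ['X^m * Q] of larger degree than [u ^+ 2], so that the
   leading coefficient of [P] is that of [- Q]. *)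
pose m := size (u ^+ 2).
pose Q := m.+1%:R *: a + c *: (b * 'X).
pose P := - ('X^m * Q) - u ^+ 2.
have sXb : size (c *: (b * 'X)) = (size b).+1.
  by rewrite size_scale ?gt_eqF// size_mulX.
have sb : (0 < size b)%N by rewrite size_poly_gt0.
have sab : (size a <= size b)%N by move: dab; rewrite /degree; lia.
have sza : (size (m.+1%:R *: a) < size (c *: (b * 'X)))%N.
  by rewrite sXb ltnS (leq_trans (size_scale_leq _ _)).
have lQ : lead_coef Q = c * lead_coef b.
  by rewrite /Q lead_coefDr// lead_coefZ lead_coefMX.
have Q0 : Q != 0 by rewrite -lead_coef_eq0 lQ mulf_eq0 (gt_eqF c0) (lt_eqF lb).
have lP : 0 < lead_coef P.
  rewrite /P lead_coefDl; last first.
    rewrite !size_polyN -/m [ltnRHS]size_monicM ?monicXn// size_polyXn/=.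
    by rewrite -[ltnLHS]addn0 ltn_add2l size_poly_gt0.
  rewrite lead_coefN lead_coefM lead_coefXn mul1r lQ oppr_gt0.
  by rewrite pmulr_rlt0.
have [M M1 HM] := eventually_pos lP.
have M0 : 0 < M by lra.
pose F (y : R) := ('X^(m.+1) : {poly R}).[y] * expR (c * G y).
exists (H u M + F M) => x x1.
have F0 y : 0 < y -> 0 <= F y.
  by move=> y0; rewrite mulr_ge0 ?expR_ge0// hornerXn exprn_ge0// ltW.
case: (leP x M) => [xM|/ltW Mx].
  by apply: (le_trans (moment_nondecreasing u _ xM)); rewrite ?lerDl ?F0//; lra.
have : H u x - H u M <= (- F) x - (- F) M.
  refine (@increment_le _ (H u) (fun z =>
      - (w z * (('X^(m.+1))^`() * a + c *: ('X^(m.+1) * b)).[z]))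
    (- F) (fun z => w z * u.[z] ^+ 2) _ _ Mx _ _ _).
  - by move=> z; rewrite in_itv/= => /andP[Mz _]; apply: dH; lra.
  - move=> z; rewrite in_itv/= => /andP[Mz _].
    have z0 : 0 < z by lra.
    by apply: is_deriveN; apply: is_derive_polyM_exp; [exact: a_gt0 | exact: dG].
  - move=> z; rewrite in_itv/= => /andP[Mz _].
    rewrite -mulrN ler_wpM2l ?exp_weight_ge0//.
    have := HM _ Mz; rewrite /P /Q derivXn !hornerE /= !hornerMn !hornerXn !exprS.
    rewrite -mulr_natl; lra.
rewrite -[(- F) x]/(- F x) -[(- F) M]/(- F M).
have := F0 x; lra.
Qed.

(** When the conditions fail, [x^(m + 1) E] is eventually nondecreasing for
    some [m], so [w a x^(m + 1)] is bounded below by a positive constant. *)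
Lemma infinity_conditions_necessary :
  0 < lead_coef a -> b != 0 ->
  (forall u, exists K, forall x : R, 1 <= x -> H u x <= K) ->
  (degree a <= degree b)%N /\ lead_coef b < 0.
Proof.
move=> la b0 bounded; apply: contrapT => /(lead_coef_moment_gt0 c0 la b0)[m lQ].
have [M M1 HM] := eventually_pos lQ.
have M0 : 0 < M by lra.
pose F (y : R) := ('X^(m.+1) : {poly R}).[y] * expR (c * G y).
have F_nd x : M <= x -> F M <= F x.
  move=> Mx; apply: (nondecreasing_derive (f := fun z =>
    w z * (('X^(m.+1))^`() * a + c *: ('X^(m.+1) * b)).[z]) Mx).
    move=> z; rewrite in_itv/= => /andP[Mz _]; have z0 : 0 < z by lra.
    by apply: is_derive_polyM_exp; [exact: a_gt0 | exact: dG].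
  move=> z; rewrite in_itv/= => /andP[Mz _].
  rewrite mulr_ge0 ?exp_weight_ge0//.
  have : 0 <= z ^+ m * (m.+1%:R *: a + c *: (b * 'X)).[z].
    by rewrite mulr_ge0 ?exprn_ge0 ?(ltW (HM _ _))//; lra.
  rewrite derivXn !hornerE /= !hornerMn !hornerXn !exprS -mulr_natl; lra.
have FM0 : 0 < F M by rewrite mulr_gt0 ?expR_gt0// hornerXn exprn_gt0.
(* With [t = x^(m + 1) a], the summand [1] gives [(1 + t)^2 >= t]. *)
pose u : {poly R} := 1 + 'X^(m.+1) * a.
have [K HK] := bounded u.
(* At speed at least [F M], the function [H u] exceeds [K] by time [x]. *)
pose x := M + (`|K - H u M| + 1) / F M.
have Mx : M <= x by rewrite lerDl divr_ge0 ?ltW// ltr_pwDr.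
have : (F M *: 'X).[x] - (F M *: 'X).[M] <= H u x - H u M.
  refine (@increment_le _ (horner (F M *: 'X)) (fun z => w z * u.[z] ^+ 2)
    (H u) (horner (F M *: 'X)^`()) _ _ Mx _ _ _).
  - by move=> z; rewrite in_itv/= => /andP[Mz _]; apply: dH; lra.
  - move=> z; rewrite in_itv/= => /andP[Mz _]; have z0 : 0 < z by lra.
    rewrite derivZ derivX hornerZ hornerC mulr1; apply: le_trans (F_nd z Mz) _.
    rewrite /F -(exp_weightM c G (a_gt0 z0)) mulrCA ler_wpM2l ?exp_weight_ge0//.
    rewrite /u !hornerE.
    have : 0 < z ^+ m.+1 * a.[z] by rewrite mulr_gt0 ?exprn_gt0 ?a_gt0.
    move: (_ * _) => t; nra.
rewrite !hornerE -mulrBr /x addrAC subrr add0r mulrC divfK ?gt_eqF//.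
have := HK x; have := ler_norm (K - H u M); rewrite -/x.
lra.
Qed.

(** * Bounded moments at zero *)

(** The function [c G - r ln x] is the logarithm of [x^(- r) E]; the logarithm
    allows negative powers of [x]. *)
Lemma is_derive_sub_ln (r x : R) : 0 < x ->
  is_derive x 1 (fun y => c * G y - r * ln y) (c * (b.[x] / a.[x]) - r / x).
Proof.
move=> x0; apply: is_deriveB; apply: is_deriveZ => //; first exact: dG.
exact: is_derive1_ln.
Qed.

Lemma expR_natM_ln (k : nat) (x : R) : 0 < x -> expR (k%:R * ln x) = x ^+ k.
Proof. by move=> x0; rewrite expRM_natl lnK. Qed.

(* The order of vanishing of [a] is [alpha + 1], so [alpha] is one less than
   the exponent in a factorisation of [a]. *)
Section AtZero.
Variables (alpha beta : nat) (A B : {poly R}).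
Hypothesis aE : a = 'X^(alpha.+1) * A.
Hypothesis bE : b = 'X^beta * B.
Hypothesis A0 : A`_0 != 0.

Lemma horner_aE x : a.[x] = x ^+ alpha.+1 * A.[x].
Proof. by rewrite aE hornerM hornerXn. Qed.

Lemma horner_bE x : b.[x] = x ^+ beta * B.[x].
Proof. by rewrite bE hornerM hornerXn. Qed.

Lemma cofactor_gt0 : 0 < A`_0.
Proof.
rewrite lt_neqAle eq_sym A0 /= leNgt; apply/negP => A_lt0.
have [|d /andP[d0 _] Hd] := @pos_near_zero _ (- A); first by rewrite coefN oppr_gt0.
have := a_gt0 d0; rewrite horner_aE pmulr_rgt0 ?exprn_gt0//.
by have := Hd d (ltW d0) (lexx d); rewrite hornerN; lra.
Qed.

Lemma cofactor_horner_gt0 x : 0 < x -> 0 < A.[x].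
Proof.
by move=> x0; have := a_gt0 x0; rewrite horner_aE pmulr_rgt0 ?exprn_gt0.
Qed.

(** Divided by [a], the hypothesis says that [c G - alpha ln x] has derivative
    at most [K].  This function is therefore bounded below near [0], that is
    [E >= const * x^alpha], and since [a] is comparable with [x^(alpha + 1)]
    the weight dominates [const / x]. *)
Lemma weight_diverges_at_zero (K d : R) : 0 <= K -> 0 < d <= 1 ->
  (forall x, 0 < x -> x <= d ->
     c * b.[x] - alpha%:R * (x ^+ alpha * A.[x]) <= K * a.[x]) ->
  ~ exists L, forall x : R, 0 < x -> x <= 1 -> L <= H 1 x.
Proof.
move=> K0 /andP[d0 d1] logd [L HL].
have [|e /andP[e0 e1] He] := @pos_near_zero _ ((2 * A`_0)%:P - A).
  by rewrite coefB coefC/=; have := cofactor_gt0; lra.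
pose t := Num.min d e.
have t0 : 0 < t by rewrite lt_min d0.
have td : t <= d by rewrite ge_min lexx.
have te : t <= e by rewrite ge_min lexx orbT.
pose l (y : R) := c * G y - alpha%:R * ln y.
have l_ge x : 0 < x -> x <= t -> l t - K <= l x.
  move=> x0 xt.
  have : l t - l x <= (K *: 'X).[t] - (K *: 'X).[x].
    refine (@increment_le _ l (horner (K *: 'X)^`()) (horner (K *: 'X))
      (fun y => c * (b.[y] / a.[y]) - alpha%:R / y) _ _ xt _ _ _).
      move=> z; rewrite in_itv/= => /andP[xz _].
      by apply: is_derive_sub_ln; lra.
    move=> z; rewrite in_itv/= => /andP[xz zt]; have z0 : 0 < z by lra.
    have := logd z z0 (le_trans zt td).
    rewrite derivZ derivX hornerZ hornerC mulr1 -ler_pdivrMr ?a_gt0//.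
    apply: le_trans; rewrite le_eqVlt; apply/orP; left; apply/eqP.
    rewrite horner_aE exprS; have := cofactor_horner_gt0 z0 => Az.
    have zn : z ^+ alpha != 0 by rewrite expf_neq0// gt_eqF.
    by field; rewrite zn !gt_eqF.
  by rewrite !hornerE -mulrBr; nra.
pose k := expR (l t - K) / (2 * A`_0).
have k0 : 0 < k by rewrite divr_gt0 ?expR_gt0// mulr_gt0// cofactor_gt0.
pose kln (y : R) := k * ln y.
have lnH x : 0 < x -> x <= t -> kln t - kln x <= H 1 t - H 1 x.
  move=> x0 xt.
  refine (@increment_le _ kln (fun z => w z * (1 : {poly R}).[z] ^+ 2)
     (H 1) (fun y => k / y) _ _ xt _ _ _).
  - move=> z; rewrite in_itv/= => /andP[xz _].
    by apply: is_deriveZ; apply: is_derive1_ln; lra.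
  - by move=> z; rewrite in_itv/= => /andP[xz _]; apply: dH; lra.
  - move=> z; rewrite in_itv/= => /andP[xz zt]; have z0 : 0 < z by lra.
    rewrite hornerC expr1n mulr1 -(ler_pM2r (a_gt0 z0)) /w exp_weightM ?a_gt0//.
    have -> : c * G z = l z + alpha%:R * ln z by rewrite /l; lra.
    rewrite expRD expR_natM_ln// horner_aE exprS.
    have -> : k / z * (z * z ^+ alpha * A.[z]) = k * A.[z] * z ^+ alpha.
      by field; rewrite gt_eqF.
    apply: ler_wpM2r; first by rewrite exprn_ge0// ltW.
    apply: (@le_trans _ _ (expR (l t - K))); last by rewrite ler_expR l_ge.
    rewrite /k mulrAC ler_pdivrMr ?mulr_gt0 ?cofactor_gt0// ler_wpM2l ?expR_ge0//.
    by have := He z (ltW z0) (le_trans zt te); rewrite hornerD hornerN hornerC; lra.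
(* Moving from [t] down to [t * expR (- s)] costs [H 1] at least [k * s]. *)
pose s := (`|H 1 t - L| + 1) / k.
have s0 : 0 < s by rewrite divr_gt0// ltr_pwDr.
have ets : expR (- s) <= 1 by rewrite -expR0 ler_expR; lra.
have x0 : 0 < t * expR (- s) by rewrite mulr_gt0// expR_gt0.
have xt : t * expR (- s) <= t by rewrite ler_piMr// ltW.
have := lnH _ x0 xt; rewrite /kln lnM ?posrE ?expR_gt0// expRK mulrDr mulrN.
rewrite /s [k * (_ / k)]mulrC divfK ?gt_eqF//.
have := HL _ x0 (le_trans xt (le_trans td d1)).
have := ler_norm (H 1 t - L); lra.
Qed.

(** If a condition fails, [c b - alpha x^alpha A] is at most [x^alpha T] for a
    polynomial [T] with [T(0) <= 0].  Then [T] is at most [x] times a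
    polynomial, hence at most [K x A] near [0] for some [K], and
    [weight_diverges_at_zero] applies. *)
Lemma zero_conditions_necessary : B`_0 != 0 ->
  (exists L, forall x : R, 0 < x -> x <= 1 -> L <= H 1 x) ->
  [/\ (beta <= alpha)%N, (beta < alpha)%N -> 0 < B`_0
    & beta = alpha -> 0 < c * B`_0 - alpha%:R * A`_0].
Proof.
move=> B0 bounded; have A_gt0 := cofactor_gt0.
have key (T : {poly R}) (e : R) : 0 < e <= 1 -> T`_0 <= 0 ->
    (forall x : R, 0 < x -> x <= e ->
       c * b.[x] - alpha%:R * (x ^+ alpha * A.[x]) <= x ^+ alpha * T.[x]) ->
    False.
  move=> /andP[e0 e1] T0 TE; pose V := drop_poly 1 T.
  have TV x : T.[x] = T`_0 + x * V.[x].
    rewrite -{1}(poly_take_drop 1 T) hornerD hornerM hornerXn expr1.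
    by rewrite (size1_polyC (size_take_poly 1 T)) coef_take_poly hornerC mulrC.
  (* This value makes the constant coefficient of [K *: A - V] positive. *)
  pose K := (`|V`_0| + 1) / A`_0.
  have K0 : 0 <= K by rewrite divr_ge0 ?ltW// ltr_pwDr.
  have [|d /andP[d0 d1] Hd] := @pos_near_zero _ (K *: A - V).
    rewrite coefB coefZ /K divfK ?gt_eqF//.
    by have := ler_norm V`_0; lra.
  have d01 : 0 < Num.min d e <= 1 by rewrite lt_min d0 e0 ge_min d1.
  apply: (weight_diverges_at_zero K0 d01 _ bounded) => x x0.
  rewrite le_min => /andP[xd xe].
  apply: le_trans (TE x x0 xe) _; rewrite horner_aE.
  have -> : K * (x ^+ alpha.+1 * A.[x]) = x ^+ alpha * (x * (K * A.[x])).
    by rewrite exprS; ring.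
  apply: ler_wpM2l; first by rewrite exprn_ge0// ltW.
  rewrite TV.
  have Kx : V.[x] < K * A.[x].
    by have := Hd x (ltW x0) xd; rewrite hornerD hornerN hornerZ; lra.
  have := ler_wpM2l (ltW x0) (ltW Kx); lra.
have e01 : 0 < (1 : R) <= 1 by rewrite ltr01 lexx.
have ba : (beta <= alpha)%N.
  rewrite leqNgt; apply/negP => ab.
  apply: (key (c *: ('X^(beta - alpha) * B) - alpha%:R *: A) 1 e01).
    rewrite coefB !coefZ coefXnM subn_gt0 ab mulr0 sub0r oppr_le0.
    by rewrite mulr_ge0// ltW.
  move=> x _ _; rewrite horner_bE hornerD hornerN !hornerZ hornerM hornerXn.
  by rewrite -{1}(subnKC (ltnW ab)) exprD le_eqVlt; apply/orP; left; apply/eqP; ring.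
split=> // [ab|ab].
- rewrite lt_neqAle eq_sym B0 /= leNgt; apply/negP => B_lt0.
  have [|d d01 Hd] := @pos_near_zero _ (- B); first by rewrite coefN oppr_gt0.
  apply: (key 0 d d01); first by rewrite coef0.
  move=> x x0 xd; rewrite horner0 mulr0 horner_bE.
  have := Hd x (ltW x0) xd; rewrite hornerN oppr_gt0 => Bx.
  have : 0 <= alpha%:R * (x ^+ alpha * A.[x]).
    by rewrite !mulr_ge0// ?exprn_ge0 ?ltW// cofactor_horner_gt0.
  have : c * (x ^+ beta * B.[x]) <= 0.
    by rewrite pmulr_rle0// pmulr_rle0 ?exprn_gt0// ltW.
  lra.
- rewrite ltNge; apply/negP => le0.
  apply: (key (c *: B - alpha%:R *: A) 1 e01); first by rewrite coefB !coefZ.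
  move=> x _ _; rewrite horner_bE ab hornerD hornerN !hornerZ le_eqVlt.
  by apply/orP; left; apply/eqP; ring.
Qed.

(** The derivative of [x^(- beta) E] is the weight times
    [c B - beta x^(alpha - beta) A].  When this polynomial is positive at [0],
    a multiple [k] of it dominates [u^2] nearby, while [x^(- beta) E] is
    nonnegative, so [H u] cannot decrease without bound towards [0]. *)
Lemma moments_bounded_at_zero : (beta <= alpha)%N ->
  0 < (c *: B - beta%:R *: ('X^(alpha - beta) * A))`_0 ->
  forall u, exists L, forall x : R, 0 < x -> x <= 1 -> L <= H u x.
Proof.
move=> ba S0 u; set S := c *: B - _ in S0.
pose k := ((u ^+ 2)`_0 + 1) / S`_0.
have k0 : 0 < k.
  by rewrite divr_gt0// -horner_coef0 horner_exp ltr_wpDl ?sqr_ge0.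
have [|d /andP[d0 d1] Hd] := @pos_near_zero _ (k *: S - u ^+ 2).
  by rewrite coefB coefZ /k divfK ?gt_eqF//; lra.
pose F (y : R) := k * expR (c * G y - beta%:R * ln y).
have F0 y : 0 <= F y by rewrite mulr_ge0 ?expR_ge0// ltW.
have HF x : 0 < x -> x <= d -> H u d - H u x <= F d - F x.
  move=> x0 xd.
  refine (@increment_le _ (H u) (fun z => k * (expR (c * G z - beta%:R * ln z)
    * (c * (b.[z] / a.[z]) - beta%:R / z))) F
    (fun z => w z * u.[z] ^+ 2) _ _ xd _ _ _).
  - by move=> z; rewrite in_itv/= => /andP[xz _]; apply: dH; lra.
  - move=> z; rewrite in_itv/= => /andP[xz _]; have z0 : 0 < z by lra.
    apply: is_deriveZ.
    exact: (@is_derive1_comp _ expR _ z _ _ (is_derive_expR _)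
      (is_derive_sub_ln _ z0)).
  - move=> z; rewrite in_itv/= => /andP[xz zd]; have z0 : 0 < z by lra.
    have wE : expR (c * G z - beta%:R * ln z) * z ^+ beta = w z * a.[z].
      by rewrite /w exp_weightM ?a_gt0// -expR_natM_ln// -expRD subrK.
    have -> : k * (expR (c * G z - beta%:R * ln z)
        * (c * (b.[z] / a.[z]) - beta%:R / z)) = w z * (k * S.[z]).
      have az := a_gt0 z0; rewrite -[w z](mulfK (lt0r_neq0 az)) -wE.
      rewrite /S hornerD hornerN !hornerZ hornerM hornerXn horner_aE horner_bE.
      have -> : z ^+ alpha.+1 = z * z ^+ beta * z ^+ (alpha - beta).
        by rewrite -mulrA -exprD subnKC// exprS.
      have Az := cofactor_horner_gt0 z0.
      have zb : z ^+ beta != 0 by rewrite expf_neq0// gt_eqF.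
      have zab : z ^+ (alpha - beta) != 0 by rewrite expf_neq0// gt_eqF.
      by field; rewrite zb zab !gt_eqF.
    rewrite ler_wpM2l ?exp_weight_ge0//.
    have := Hd z (ltW z0) (le_trans zd (lexx d)).
    by rewrite hornerD hornerN hornerZ horner_exp; lra.
exists (H u d - F d) => x x0 x1; case: (leP x d) => [xd|/ltW dx].
  by have := HF x x0 xd; have := F0 x; lra.
have := moment_nondecreasing u d0 dx; have := F0 d; lra.
Qed.

End AtZero.

End HalfLine.
End Weights.

(** * Finite norm on the line and on the half line *)

Section FiniteNorm.
Context {R : realType}.
Implicit Types (a b u : {poly R}).

Definition quotient_primitive a b (p0 : R) : R -> R :=
  oriented_integral (fun t => b.[t] / a.[t]) p0.

Definition norm_primitive n a b (p0 : R) u : R -> R :=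
  oriented_integral (fun x => weight n a b p0 x * u.[x] ^+ 2) p0.

Section OpenInterval.
Variables (I : set R) (n : nat) (a b : {poly R}) (p0 : R).
Hypothesis oI : open I.
Hypothesis iI : is_interval I.
Hypothesis a0 : forall x, I x -> a.[x] != 0.
Hypothesis Ip0 : I p0.

Lemma is_derive_quotient_primitive x : I x ->
  is_derive x 1 (quotient_primitive a b p0) (b.[x] / a.[x]).
Proof.
move=> Ix.
apply: (is_derive_oriented_integral (f := fun t => b.[t] / a.[t]) oI iI) => //.
move=> y Iy; apply: cvgM; first exact: continuous_horner.
by apply: cvgV; [exact: a0 | exact: continuous_horner].
Qed.

Lemma continuous_weight_sqr u x : I x ->
  {for x, continuous (fun x => weight n a b p0 x * u.[x] ^+ 2)}.
Proof.
move=> Ix; apply: cvgM; last first.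
  under [X in X @ _ --> _]eq_fun do rewrite -horner_exp.
  by rewrite -horner_exp; exact: continuous_horner.
apply: cvgM.
  apply: cvgV; first by rewrite normr_eq0 a0.
  by apply: cvg_norm; exact: continuous_horner.
apply: continuous_comp; last exact: continuous_expR.
apply: cvgM; first exact: cvg_cst.
apply: differentiable_continuous; apply/derivable1_diffP.
by have [] := is_derive_quotient_primitive Ix.
Qed.

Lemma is_derive_norm_primitive u x : I x ->
  is_derive x 1 (norm_primitive n a b p0 u) (weight n a b p0 x * u.[x] ^+ 2).
Proof.
move=> Ix; apply: (is_derive_oriented_integral
  (f := fun x => weight n a b p0 x * u.[x] ^+ 2) oI iI) => //.
by move=> y; exact: continuous_weight_sqr.
Qed.

(** From here on, finite norm for all polynomials is a statement about bounds
    of the primitives at each end separately. *)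
Lemma finite_norm_primitive (s t : R^nat) (p q : R) :
  nonincreasing_seq s -> nondecreasing_seq t -> (forall k, s k <= t k) ->
  I = \bigcup_k (`[s k, t k]%classic) -> I p -> I q ->
  finite_norm_all_poly I (weight n a b p0) <->
  (forall u,
    (exists K, forall x, I x -> p <= x -> norm_primitive n a b p0 u x <= K) /\
    (exists K, forall x, I x -> x <= q -> K <= norm_primitive n a b p0 u x)).
Proof.
move=> ns nt st IE Ip Iq.
have iff u := @integral_lt_pinfty_primitive _ I s t
  (fun x => weight n a b p0 x * u.[x] ^+ 2) (norm_primitive n a b p0 u) p q
  oI iI ns nt st IE (@continuous_weight_sqr u)
  (fun x _ => mulr_ge0 (exp_weight_ge0 _ _ _ x) (sqr_ge0 _))
  (@is_derive_norm_primitive u) Ip Iq.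
by split=> fin u; apply/iff; exact: fin.
Qed.

End OpenInterval.

Lemma setT_bigcup_segments :
  [set: R] = \bigcup_k (`[- k%:R, k%:R]%classic).
Proof.
apply/seteqP; split=> // x _; exists (Num.truncn `|x|).+1 => //=.
by rewrite in_itv/= -ler_norml ltW// truncnS_gt.
Qed.

Lemma itv0y_bigcup_segments :
  `]0, +oo[%classic = \bigcup_k (`[(k.+1%:R)^-1 : R, k.+1%:R]%classic).
Proof.
apply/seteqP; split=> x /=.
  rewrite in_itv/= andbT => x0.
  exists (Num.truncn (x + x^-1)) => //=; rewrite in_itv/=.
  have H := truncnS_gt (x + x^-1).
  have xV0 : 0 < x^-1 by rewrite invr_gt0.
  rewrite invf_ple ?posrE//; apply/andP; split; lra.
move=> [k _ /=]; rewrite !in_itv/= andbT => /andP[kx _].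
by apply: lt_le_trans kx; rewrite invr_gt0.
Qed.

(** The sign produced by reflecting a primitive is the reason why the reflected
    numerator is [- b(- x)] and not [b(- x)]. *)
Lemma is_derive_reflect (F : R -> R) (l x : R) : is_derive (- x) 1 F l ->
  is_derive x 1 (fun y => F (- y)) (- l).
Proof.
move=> dF.
have := @is_derive1_comp _ F -%R x _ _ dF (is_deriveNid x 1).
by rewrite mulrN1.
Qed.

Lemma finite_norm_line (n : nat) a b : (1 <= n)%N -> a \is monic -> b != 0 ->
  (forall x : R, ~~ root a x) -> forall p0 : R,
  finite_norm_all_poly [set: R] (weight n a b p0) <->
  [/\ (0 < degree b - degree a)%N, odd (degree b - degree a)
     & lead_coef b < 0].
Proof.
move=> n1 ma b0 nra p0.
have c0 : 0 < 2 / n%:R :> R by rewrite divr_gt0// ltr0n.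
have la : 0 < lead_coef a by rewrite (eqP ma).
have a_gt0 (x : R) : 0 < a.[x].
  by apply: (@horner_gt0_of_noroot _ a (x - 1)) => //; lra.
pose c : R := 2 / n%:R; pose G := quotient_primitive a b p0.
pose H := norm_primitive n a b p0.
have aT (x : R) : [set: R] x -> a.[x] != 0 by move=> _; rewrite gt_eqF.
have iT : is_interval [set: R] by [].
have dG (x : R) : is_derive x 1 G (b.[x] / a.[x]).
  exact: (is_derive_quotient_primitive b openT iT aT I I).
have dH u (x : R) : is_derive x 1 (H u) (exp_weight a c G x * u.[x] ^+ 2).
  exact: (is_derive_norm_primitive n b openT iT aT I u I).
pose a' := a \Po - 'X; pose b' := - (b \Po - 'X).
pose G' (x : R) := G (- x); pose H' u (x : R) := - H (u \Po - 'X) (- x).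
have a'_gt0 (x : R) : 0 < x -> 0 < a'.[x] by rewrite horner_reflect.
have dG' (x : R) : 0 < x -> is_derive x 1 G' (b'.[x] / a'.[x]).
  move=> _; rewrite /a' /b' hornerN !horner_reflect mulNr.
  exact: (is_derive_reflect (dG (- x))).
have dH' u (x : R) : 0 < x ->
    is_derive x 1 (H' u) (exp_weight a' c G' x * u.[x] ^+ 2).
  move=> _; rewrite /exp_weight /a' /G' horner_reflect.
  have D := is_deriveN (is_derive_reflect (dH (u \Po - 'X) (- x))).
  by apply: is_derive_eq D _; rewrite opprK horner_reflect opprK.
have b'0 : b' != 0.
  by rewrite -lead_coef_eq0 lead_coefN lead_coef_reflect oppr_eq0 mulf_eq0
    signr_eq0 lead_coef_eq0.
have la' := lead_coef_gt0_of_horner a'_gt0.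
(* Both [a] and its reflection are positive far to the right. *)
have a_even : ~~ odd (degree a).
  move: la'; rewrite lead_coef_reflect (eqP ma) mulr1 -signr_odd.
  by case: odd => //; rewrite expr1; lra.
have db' : degree b' = degree b.
  by rewrite /b' /degree size_polyN; exact: degree_reflect.
have lb' : lead_coef b' = - ((-1) ^+ odd (degree b) * lead_coef b).
  by rewrite lead_coefN lead_coef_reflect signr_odd.
rewrite (@finite_norm_primitive _ n a b p0 openT iT aT I _ _ 1 (-1) _ _ _
  setT_bigcup_segments)//; last 3 first.
- by move=> i j ij; rewrite lerN2 ler_nat.
- by move=> i j ij; rewrite ler_nat.
- by move=> k; rewrite ge0_cp.
rewrite -/H; split=> [bounded|[dab odd_ab lb] u].
- have [|dab lb] := @infinity_conditions_necessary _ a b c G H c0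
    (fun x _ => a_gt0 x) (fun x _ => dG x) (fun u x _ => dH u x) la b0.
    by move=> u; have [[K HK] _] := bounded u; exists K => x; exact: HK.
  have [|dab' lb''] := infinity_conditions_necessary c0 a'_gt0 dG' dH' la' b'0.
    move=> u; have [_ [K HK]] := bounded (u \Po - 'X); exists (- K) => x x1.
    by rewrite lerN2; apply: HK => //; rewrite lerN2.
  have b_odd : odd (degree b).
    by move: lb''; rewrite lb'; case: odd => //; rewrite expr0 mul1r; lra.
  have dE : odd (degree b - degree a) by rewrite oddB// b_odd (negPf a_even).
  by split => //; case: (_ - _)%N dE.
- have ab : (degree a <= degree b)%N by lia.
  have b_odd : odd (degree b) by move: odd_ab; rewrite oddB// (negPf a_even) addbF.
  split.
    have [K HK] := @moments_bounded_at_infinity _ a b c G H c0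
      (fun x _ => a_gt0 x) (fun x _ => dG x) (fun u x _ => dH u x) b0 ab lb u.
    by exists K => x _; exact: HK.
  have [||K HK] := moments_bounded_at_infinity c0 a'_gt0 dG' dH' b'0 _ _ (u \Po - 'X).
  + by rewrite degree_reflect db'.
  + by rewrite lb' b_odd expr1; lra.
  exists (- K) => x _ x1; have := HK (- x); rewrite /H' reflectK opprK.
  by move=> HKx; rewrite lerNl; apply: HKx; lra.
Qed.

Lemma subSn_gt1 (m k : nat) : (m <= k)%N -> (1 < k.+1 - m)%N = (m < k)%N.
Proof. by move=> mk; rewrite subSn// ltnS subn_gt0. Qed.

Lemma subSn_eq1 (m k : nat) : (m <= k)%N -> (k.+1 - m = 1)%N <-> m = k.
Proof. lia. Qed.

(** The case distinction on [alpha - beta] expresses a single condition: the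
    polynomial [c B - beta x^(alpha - 1 - beta) A] is positive at [0], where
    the second term has a constant coefficient only if [alpha - beta = 1]. *)
Lemma finite_norm_half_line (n : nat) a b (alpha beta : nat) (A B : {poly R}) :
  (1 <= n)%N -> a \is monic -> b != 0 ->
  (forall x : R, root a x <-> x = 0) ->
  a = 'X^alpha * A -> A`_0 != 0 -> b = 'X^beta * B -> B`_0 != 0 ->
  forall p0 : R, p0 \in `]0, +oo[ ->
  finite_norm_all_poly `]0, +oo[ (weight n a b p0) <->
  [/\ (degree a <= degree b)%N, lead_coef b < 0
    & [/\ (1 <= alpha - beta)%N,
          (2 <= alpha - beta)%N -> 0 < B`_0 / A`_0
        & (alpha - beta = 1)%N ->
          0 < 2 * B`_0 / (n%:R * A`_0) - alpha%:R + 1]].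
Proof.
move=> n1 ma b0 ra aE A0 bE B0 p0 p0I.
have n0 : 0 < n%:R :> R by rewrite ltr0n.
pose c : R := 2 / n%:R; have c0 : 0 < c by rewrite divr_gt0.
have la : 0 < lead_coef a by rewrite (eqP ma).
have a_gt0 (x : R) : 0 < x -> 0 < a.[x].
  apply: (@horner_gt0_of_noroot _ a 0) => // y y0.
  by apply/negP => /ra y00; rewrite y00 ltxx in y0.
(* The root [0] of [a] must come from the power of ['X], as [A] has none. *)
have [k alphaE] : exists k, alpha = k.+1.
  case: alpha aE => [|k _]; last by exists k.
  rewrite expr0 mul1r => aA; have /ra : (0 : R) = 0 by [].
  by rewrite rootE aA horner_coef0 (negPf A0).
subst alpha.
pose I : set R := `]0, +oo[%classic.
have IP (x : R) : I x <-> 0 < x by rewrite /I /= in_itv/= andbT.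
have oI : open I by exact: interval_open.
have iI : is_interval I by exact: interval_is_interval.
have aI x : I x -> a.[x] != 0 by move=> /IP /a_gt0 ax; rewrite gt_eqF.
have Ip0 : I p0 by [].
pose G := quotient_primitive a b p0; pose H := norm_primitive n a b p0.
have dG (x : R) : 0 < x -> is_derive x 1 G (b.[x] / a.[x]).
  by move=> x0; apply: (is_derive_quotient_primitive b oI iI aI Ip0); apply/IP.
have dH u (x : R) : 0 < x ->
    is_derive x 1 (H u) (exp_weight a c G x * u.[x] ^+ 2).
  by move=> x0; apply: (is_derive_norm_primitive n b oI iI aI Ip0); apply/IP.
have A_gt0 := cofactor_gt0 a_gt0 aE A0.
have condE : 2 * B`_0 / (n%:R * A`_0) - k.+1%:R + 1 =
    (c * B`_0 - k%:R * A`_0) / A`_0.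
  by rewrite /c -natr1; field; rewrite !gt_eqF.
have I1 : I 1 by apply/IP.
rewrite (@finite_norm_primitive I n a b p0 oI iI aI Ip0 _ _ 1 1 _ _ _
  itv0y_bigcup_segments I1 I1); last 3 first.
- by move=> i j ij; rewrite lef_pV2 ?posrE ?ltr0n// ler_nat.
- by move=> i j ij; rewrite ler_nat.
- by move=> i; rewrite (@le_trans _ _ 1)// ?invf_le1 ?ltr0n// ler1n.
rewrite -/H; split=> [bounded|[dab lb [ab ab2 ab1]] u].
- have [|dab lb] := infinity_conditions_necessary c0 a_gt0 dG dH la b0.
    move=> u; have [[K HK] _] := bounded u; exists K => x x1.
    by apply: HK => //; apply/IP; lra.
  have [|ba B_gt0 S_gt0] := zero_conditions_necessary c0 a_gt0 dG dH aE bE A0 B0.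
    have [_ [K HK]] := bounded 1; exists K => x x0 x1.
    by apply: HK => //; apply/IP.
  split=> //; split; first by rewrite subn_gt0 ltnS.
    by rewrite subSn_gt1// => /B_gt0 ?; rewrite divr_gt0.
  by move=> /(subSn_eq1 ba)/S_gt0 ?; rewrite condE divr_gt0.
- split.
    have [K HK] := moments_bounded_at_infinity c0 a_gt0 dG dH b0 dab lb u.
    by exists K => x _; exact: HK.
  have ba : (beta <= k)%N by rewrite -ltnS -subn_gt0.
  have S0 : 0 < (c *: B - beta%:R *: ('X^(k - beta) * A))`_0.
    rewrite coefB !coefZ coefXnM subn_gt0.
    case: (ltngtP beta k) ba => // [kb|kE] _.
      rewrite mulr0 subr0 mulr_gt0//.
      have := ab2; rewrite (subSn_gt1 (ltnW kb)) => /(_ kb).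
      by rewrite pmulr_lgt0 ?invr_gt0.
    have := ab1; rewrite condE pmulr_lgt0 ?invr_gt0// kE subnn.
    by apply; rewrite subSnn.
  have [K HK] := moments_bounded_at_zero a_gt0 dG dH aE bE ba S0 u.
  by exists K => x /IP x0; exact: HK.
Qed.

End FiniteNorm.

Unset Implicit Arguments.

(* Every truncated difference of naturals below is compared with a positive
   number or required to be positive, so truncation is harmless. *)
Theorem proposition3p3 (R : realType) (n : nat) (a b : {poly R})
    (hn : (1 <= n)%N)
    (ha : a \is monic) (hdega : (degree a <= n)%N)
    (hb : b != 0) (hdegb : (degree b <= n - 1)%N) :
  ((forall x : R, ~~ root a x) ->
   forall p0 : R,
     finite_norm_all_poly [set: R] (weight n a b p0) <->
     [/\ (0 < degree b - degree a)%N, odd (degree b - degree a)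
       & lead_coef b < 0])
  /\
  ((forall x : R, root a x <-> x = 0) ->
   forall p0 : R, p0 \in `]0, +oo[ ->
   forall (alpha beta : nat) (A B : {poly R}),
     a = 'X^alpha * A -> A`_0 != 0 ->
     b = 'X^beta * B -> B`_0 != 0 ->
     finite_norm_all_poly `]0, +oo[ (weight n a b p0) <->
     [/\ (degree a <= degree b)%N, lead_coef b < 0
       & [/\ (1 <= alpha - beta)%N,
             (2 <= alpha - beta)%N -> 0 < B`_0 / A`_0
           & (alpha - beta = 1)%N ->
             0 < 2 * B`_0 / (n%:R * A`_0) - alpha%:R + 1]]).
Proof.
split=> [nra p0|ra p0 p0I alpha beta A B aE A0 bE B0].
  exact: finite_norm_line.
exact: (finite_norm_half_line hn ha hb ra aE A0 bE B0).
Qed.
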